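(* Let $\Gamma=(\gamma_{ij})$ be a skew-symmetric $n\times n$ matrix over $\mathbf{k}$, let $P=(p_1,\dots,p_n),Q=(q_1,\dots,q_n)\in\mathbf{k}^n$ with $p_i\ne q_i$ for all $i$, and let $A_n=A_{n,\Gamma}^{P,Q}$. (a) For every prime Poisson ideal $P'$ of $A_n$, the set $P'\cap\mathcal P_n$ is an admissible set. (b) For an admissible set $T$, let $\operatorname{pspec}_TA_n=\{P'\in\operatorname{pspec}A_n\mid P'\cap\mathcal P_n=T\}$. Then $\operatorname{pspec}A_n$ is the disjoint union of all $\operatorname{pspec}_TA_n$, that is, $$\operatorname{pspec}A_n=\biguplus_T\operatorname{pspec}_TA_n,$$ where $T$ runs over all admissible sets.
   Context: $\mathbf{k}$ is an algebraically closed field of characteristic zero. A Poisson algebra is a commutative $\mathbf{k}$-algebra with a $\mathbf{k}$-bilinear Lie bracket $\{\cdot,\cdot\}$ satisfying $\{ab,c\}=a\{b,c\}+b\{a,c\}$; a Poisson ideal is an ideal $I$ with $\{I,A\}\subseteq I$; a prime Poisson ideal is a prime ideal that is also a Poisson ideal, and $\operatorname{pspec}A$ is the set of prime Poisson ideals of $A$. $A_n=A_{n,\Gamma}^{P,Q}$ is the polynomial ring $\mathbf{k}[y_1,x_1,\dots,y_n,x_n]$ with the Poisson bracket determined by $\{y_i,y_j\}=\gamma_{ij}y_iy_j$ (all $i,j$); $\{x_i,y_j\}=(p_j-\gamma_{ij})y_jx_i$ ($i<j$); $\{y_i,x_j\}=-(q_i+\gamma_{ij})y_ix_j$ ($i<j$);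 $\{x_i,x_j\}=(q_i-p_j+\gamma_{ij})x_ix_j$ ($i<j$); $\{x_i,y_i\}=q_iy_ix_i+\sum_{k=1}^{i-1}(q_k-p_k)y_kx_k$ (all $i$). Put $\Omega_i=\sum_{k=1}^i(q_k-p_k)y_kx_k$ for $i=1,\dots,n$ and $\mathcal P_n=\{\Omega_1,y_1,x_1,\dots,\Omega_n,y_n,x_n\}$. A subset $T\subseteq\mathcal P_n$ is admissible if (a) for $2\le i\le n$: ($y_i\in T$ or $x_i\in T$) $\Leftrightarrow$ ($\Omega_i\in T$ and $\Omega_{i-1}\in T$); (b) ($y_1\in T$ or $x_1\in T$) $\Leftrightarrow$ $\Omega_1\in T$. *)

(* Defs.v *)
From HB Require Import structures.
From mathcomp Require Import all_boot all_order all_algebra.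
From mathcomp Require Import ring mpoly ring_quotient.
From mathcomp Require Import classical_sets.

Set Implicit Arguments.
Unset Strict Implicit.
Unset Printing Implicit Defensive.

Import GRing.Theory.

Local Open Scope ring_scope.
Local Open Scope classical_set_scope.

Record is_poisson_bracket (k : fieldType) (A : comAlgType k)
    (br : A -> A -> A) : Prop := IsPoissonBracket {
  poisson_linearl : forall c : A, linear (br^~ c);
  poisson_linearr : forall a : A, linear (br a);
  poisson_alt : forall a, br a a = 0;
  poisson_jacobi : forall a b c,
    br (br a b) c + br (br b c) a + br (br c a) b = 0;
  poisson_leibniz : forall a b c, br (a * b) c = a * br b c + b * br a c
}.

Record poissonBracket (k : fieldType) (A : comAlgType k) := PoissonBracket {
  poisson_fun :> A -> A -> A;
  poisson_funP : is_poisson_bracket poisson_fun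
}.

Section PoissonSpectrum.
Context (k : fieldType) (A : comAlgType k) (br : poissonBracket A).

(* [idealr_closed] already requires ideals to be proper. *)
Definition prime_poisson_ideal (I : set A) : Prop :=
  [/\ idealr_closed (mem I), prime_idealr_closed (mem I)
    & forall a b, I a -> I (br a b)].

Definition pspec : set (set A) := [set I | prime_poisson_ideal I].

End PoissonSpectrum.

Section PoissonBracketTheory.
Context (k : fieldType) (A : comAlgType k) (br : A -> A -> A).
Hypothesis brP : is_poisson_bracket br.

Lemma poisson_anti a b : br a b = - br b a.
Proof.
have [Ll Lr alt _ _] := brP.
have D1 u v w : br (u + v) w = br u w + br v w.
  by have := Ll w 1 u v; rewrite !scale1r.
have D2 u v w : br u (v + w) = br u v + br u w.
  by have := Lr u 1 v w; rewrite !scale1r.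
have := alt (a + b); rewrite D1 !D2 !alt add0r addr0 => /eqP.
by rewrite addr_eq0 => /eqP.
Qed.

End PoissonBracketTheory.

(* Variable [lshift n i] of {mpoly k[n + n]} is y_(i+1) and [rshift n i] is
   x_(i+1): indices start at 0 here. *)
Section Algebra.
Context (k : fieldType) (n : nat).
Local Notation A := {mpoly k[n + n]}.

Definition yvar (i : 'I_n) : A := 'X_(lshift n i).
Definition xvar (i : 'I_n) : A := 'X_(rshift n i).

Variables (P Q : 'rV[k]_n) (Gamma : 'M[k]_n).
Local Notation p i := (P 0 i).
Local Notation q i := (Q 0 i).
Local Notation g i j := (Gamma i j).

Definition Omega (i : 'I_n) : A :=
  \sum_(j < n | (j <= i)%N) (q j - p j) *: (yvar j * xvar j).

(* The relations are given for i < j and i = j; the cases j < i below are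
   forced by skew-symmetry. *)
Definition bracket_xy (i j : 'I_n) : A :=
  if (i < j)%N then (p j - g i j) *: (yvar j * xvar i)
  else if (j < i)%N then (q j + g j i) *: (yvar j * xvar i)
  else q i *: (yvar i * xvar i)
       + \sum_(l < n | (l < i)%N) (q l - p l) *: (yvar l * xvar l).

Definition bracket_xx (i j : 'I_n) : A :=
  if (i < j)%N then (q i - p j + g i j) *: (xvar i * xvar j)
  else if (j < i)%N then - (q j - p i + g j i) *: (xvar i * xvar j)
  else 0.

Definition bracket_var (u v : 'I_(n + n)) : A :=
  match split u, split v with
  | inl i, inl j => g i j *: (yvar i * yvar j)
  | inr i, inl j => bracket_xy i j
  | inl i, inr j => - bracket_xy j i
  | inr i, inr j => bracket_xx i j
  end.

(* The unique biderivation with the prescribed values on the variables; see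
   [An_bracketP] and [An_bracket_uniq]. *)
Definition An_bracket (f h : A) : A :=
  \sum_(u < n + n) \sum_(v < n + n) bracket_var u v * (mderiv u f * mderiv v h).

End Algebra.

Section BracketTheory.
Context (k : fieldType) (n : nat).
Local Notation A := {mpoly k[n + n]}.
Local Notation y := (@yvar k n).
Local Notation x := (@xvar k n).

Lemma derivation_mpoly m (D : {mpoly k[m]} -> {mpoly k[m]}) :
  linear D -> (forall a b, D (a * b) = a * D b + b * D a) ->
  forall f, D f = \sum_(u < m) D 'X_u * mderiv u f.
Proof.
move=> Dlin DM.
have DD u v : D (u + v) = D u + D v by have := Dlin 1 u v; rewrite !scale1r.
have D0 : D 0 = 0 by apply: (addrI (D 0)); rewrite -DD !addr0.
have DZ c u : D (c *: u) = c *: D u.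
  by have := Dlin c u 0; rewrite !addr0 D0 addr0.
pose E f := D f = \sum_(u < m) D 'X_u * mderiv u f.
have EM a b : E a -> E b -> E (a * b).
  rewrite /E DM => -> ->; rewrite !mulr_sumr -big_split /=.
  by apply: eq_bigr => u _; rewrite mderivM; ring.
have E1 : E 1.
  rewrite /E big1 => [|u _]; last by rewrite -mpolyC1 mderivC mulr0.
  by apply: (addrI (D 1)); rewrite addr0 -[RHS](congr1 D (mulr1 1)) DM mul1r.
have EX i : E 'X_i.
  rewrite /E (bigD1 i) //= mderivX mnm1E eqxx scale1r.
  rewrite big1 ?addr0 => [|j /negPf ji]; last first.
    by rewrite mderivX mnm1E eq_sym ji scale0r mulr0.
  suff -> : (U_(i) - U_(i))%MM = 0%MM by rewrite mpolyX0 mulr1.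
  by apply/mnmP => j; rewrite mnmBE mnm0E subnn.
move=> f; elim/mpolyind: f => [|c mm f _ _ IH].
  by rewrite D0 big1 // => u _; rewrite mderiv0 mulr0.
have EXm : E 'X_[mm].
  rewrite mpolyXE_id; elim/big_ind: _ => // i _.
  by elim: (mm i) => [|e IHe]; rewrite ?expr0 // exprS; apply: EM.
rewrite DD DZ IH EXm scaler_sumr -big_split; apply: eq_bigr => u _ /=.
by rewrite mderivD mderivZ mulrDr scalerAr.
Qed.

Lemma split_lshift (i : 'I_n) : split (lshift n i) = inl i.
Proof. exact: (unsplitK (inl i)). Qed.

Lemma split_rshift (i : 'I_n) : split (rshift n i) = inr i.
Proof. exact: (unsplitK (inr i)). Qed.

Variables (P Q : 'rV[k]_n) (Gamma : 'M[k]_n).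
Hypothesis k_char0 : [pchar k] =i pred0.
Hypothesis Gamma_skew : Gamma^T = - Gamma.
Local Notation p i := (P 0 i).
Local Notation q i := (Q 0 i).
Local Notation g i j := (Gamma i j).
Local Notation bv := (bracket_var P Q Gamma).
Local Notation br := (An_bracket P Q Gamma).

Lemma skewE i j : g j i = - g i j.
Proof. by have /matrixP/(_ i j) := Gamma_skew; rewrite !mxE. Qed.

Lemma skew_diag i : g i i = 0.
Proof.
have /eqP := skewE i i; rewrite -addr_eq0 -mulr2n -mulr_natl mulf_eq0.
by have := k_char0 2; rewrite !inE /= => ->  /= /eqP.
Qed.

Lemma bracket_var_skew u v : bv v u = - bv u v.
Proof.
rewrite /bracket_var; case: (split u) => i; case: (split v) => j.
- by rewrite skewE scaleNr mulrC.
- by rewrite opprK.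
- by [].
rewrite /bracket_xx; case: ltngtP => // _; last by rewrite oppr0.
- by rewrite mulrC -scaleNr opprK.
- by rewrite mulrC -scaleNr.
Qed.

Lemma bracket_var_diag u : bv u u = 0.
Proof.
rewrite /bracket_var; case: (split u) => i; first by rewrite skew_diag scale0r.
by rewrite /bracket_xx ltnn.
Qed.

Lemma br_linearl c : linear (br^~ c).
Proof.
move=> a f h; rewrite /An_bracket scaler_sumr -big_split; apply: eq_bigr => u _.
rewrite scaler_sumr -big_split; apply: eq_bigr => v _ /=.
by rewrite mderivD mderivZ mulrDl mulrDr -scalerAl -scalerAr.
Qed.

Lemma br_skew f h : br h f = - br f h.
Proof.
rewrite /An_bracket exchange_big -sumrN; apply: eq_bigr => u _ /=.
rewrite -sumrN; apply: eq_bigr => v _.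
by rewrite bracket_var_skew mulNr [mderiv v _ * _]mulrC.
Qed.

Lemma br_linearr c : linear (br c).
Proof.
by move=> a f h; rewrite br_skew br_linearl opprD -scalerN -!br_skew.
Qed.

Lemma br_leibniz a b c : br (a * b) c = a * br b c + b * br a c.
Proof.
rewrite /An_bracket !mulr_sumr -big_split; apply: eq_bigr => u _ /=.
rewrite !mulr_sumr -big_split; apply: eq_bigr => v _ /=.
by rewrite mderivM; ring.
Qed.

Lemma br_leibnizr a b c : br c (a * b) = a * br c b + b * br c a.
Proof. by rewrite br_skew br_leibniz opprD -!mulrN -!br_skew. Qed.

Lemma br_alt f : br f f = 0.
Proof.
have /eqP := br_skew f f; rewrite -addr_eq0 -mulr2n -scaler_nat scaler_eq0.
by have := k_char0 2; rewrite !inE /= => -> /= /eqP.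
Qed.

Lemma brDl a b c : br (a + b) c = br a c + br b c.
Proof. by have := br_linearl c 1 a b; rewrite !scale1r. Qed.
Lemma brDr a b c : br c (a + b) = br c a + br c b.
Proof. by have := br_linearr c 1 a b; rewrite !scale1r. Qed.
Lemma br0l c : br 0 c = 0.
Proof. by apply: (addrI (br 0 c)); rewrite -brDl !addr0. Qed.
Lemma brZl e a c : br (e *: a) c = e *: br a c.
Proof. by have := br_linearl c e a 0; rewrite !addr0 br0l addr0. Qed.
Lemma brNl a c : br (- a) c = - br a c.
Proof. by rewrite -scaleN1r brZl scaleN1r. Qed.
Lemma br_suml (I : finType) (R : pred I) F c :
  br (\sum_(i | R i) F i) c = \sum_(i | R i) br (F i) c.
Proof.
elim/big_rec2: _ => [|i a b _ <-]; first exact: br0l.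
by rewrite brDl.
Qed.

Lemma br_var u v : br 'X_u 'X_v = bv u v.
Proof.
have dX i j : mderiv i 'X_j = (i == j)%:R :> A.
  rewrite mderivX mnm1E eq_sym; case: eqP => [->|_]; last by rewrite scale0r.
  rewrite scale1r; suff -> : (U_(j) - U_(j))%MM = 0%MM by rewrite mpolyX0.
  by apply/mnmP => l; rewrite mnmBE mnm0E subnn.
rewrite /An_bracket (bigD1 u) //= (bigD1 v) //= !dX !eqxx !mulr1.
rewrite big1 ?addr0 => [|i /negPf iv]; last by rewrite !dX iv !mulr0.
rewrite big1 ?addr0 // => i /negPf iu.
by rewrite big1 // => j _; rewrite !dX iu mul0r mulr0.
Qed.

Lemma An_bracket_yy i j : br (y i) (y j) = g i j *: (y i * y j).
Proof. by rewrite br_var /bracket_var !split_lshift. Qed.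

Lemma An_bracket_xyE i j : br (x i) (y j) = bracket_xy P Q Gamma i j.
Proof. by rewrite br_var /bracket_var split_lshift split_rshift. Qed.

Lemma An_bracket_xy (i j : 'I_n) :
  (i < j)%N -> br (x i) (y j) = (p j - g i j) *: (y j * x i).
Proof. by move=> ij; rewrite An_bracket_xyE /bracket_xy ij. Qed.

Lemma An_bracket_yx (i j : 'I_n) :
  (i < j)%N -> br (y i) (x j) = - (q i + g i j) *: (y i * x j).
Proof.
move=> ij; rewrite br_skew An_bracket_xyE /bracket_xy ltnNge ltnW //= ij.
by rewrite scaleNr.
Qed.

Lemma An_bracket_xxE i j : br (x i) (x j) = bracket_xx P Q Gamma i j.
Proof. by rewrite br_var /bracket_var !split_rshift. Qed.

Lemma An_bracket_xx (i j : 'I_n) :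
  (i < j)%N -> br (x i) (x j) = (q i - p j + g i j) *: (x i * x j).
Proof. by move=> ij; rewrite An_bracket_xxE /bracket_xx ij. Qed.

Lemma An_bracket_xy_diag i :
  br (x i) (y i) = q i *: (y i * x i)
    + \sum_(l < n | (l < i)%N) (q l - p l) *: (y l * x l).
Proof. by rewrite An_bracket_xyE /bracket_xy ltnn. Qed.

Let jac a b c := br (br a b) c + br (br b c) a + br (br c a) b.
Let Om i := \sum_(l < n | (l < i)%N) (q l - p l) *: (y l * x l).
Let vidx (u : 'I_(n + n)) := match split u with inl i => i | inr i => i end.
(* Bracketing with a variable of index j rescales both y_i x_i (i != j) and the
   partial sums Omega_(i-1), by the same factor. *)
Let wt (i : 'I_n) (v : 'I_(n + n)) : k :=
  match split v with
  | inl j => if (i < j)%N then p j else q j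
  | inr j => if (i < j)%N then - p j else - q j
  end.

Let br_var_log u v : vidx u != vidx v -> exists e, br 'X_u 'X_v = e *: ('X_u * 'X_v).
Proof.
rewrite /vidx; case: (split_ordP u) => i ->; case: (split_ordP v) => j ->;
  rewrite ?split_lshift ?split_rshift -!/(yvar _ _) -!/(xvar _ _)=> ij.
- by exists (g i j); exact: An_bracket_yy.
- case: (ltngtP i j) ij => [ij _|ij _|/val_inj ->]; last by rewrite eqxx.
  + by exists (- (q i + g i j)); exact: An_bracket_yx.
  + by exists (- (p i - g j i)); rewrite br_skew An_bracket_xy // scaleNr.
- case: (ltngtP i j) ij => [ij _|ij _|/val_inj ->]; last by rewrite eqxx.
  + by exists (p j - g i j); rewrite [x i * _]mulrC; exact: An_bracket_xy.
  + exists (q j + g j i); rewrite br_skew An_bracket_yx // scaleNr opprK.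
    by rewrite [x i * _]mulrC.
- case: (ltngtP i j) ij => [ij _|ij _|/val_inj ->]; last by rewrite eqxx.
  + by exists (q i - p j + g i j); exact: An_bracket_xx.
  + exists (- (q j - p i + g j i)); rewrite br_skew An_bracket_xx //.
    by rewrite scaleNr [x i * _]mulrC.
Qed.

Let br_yx_var (i : 'I_n) v : i != vidx v ->
  br (y i * x i) 'X_v = wt i v *: (y i * x i * 'X_v).
Proof.
rewrite br_leibniz /vidx /wt; case: (split_ordP v) => j ->;
  rewrite ?split_lshift ?split_rshift -?/(yvar _ _) -?/(xvar _ _) => ij.
- case: (ltngtP i j) ij => [ij _|ij _|/val_inj ->]; last by rewrite eqxx.
  + by rewrite An_bracket_xy // An_bracket_yy -!mul_mpolyC rmorphB /=; ring.
  + rewrite (br_skew (y j)) An_bracket_yx // An_bracket_yy (skewE j i).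
    by rewrite -!mul_mpolyC !rmorphN rmorphD /=; ring.
- case: (ltngtP i j) ij => [ij _|ij _|/val_inj ->]; last by rewrite eqxx.
  + rewrite An_bracket_xx // An_bracket_yx // -!mul_mpolyC !rmorphN !rmorphD.
    by rewrite rmorphN /=; ring.
  + rewrite (br_skew (x j) (x i)) (br_skew (x j)) An_bracket_xx //.
    rewrite An_bracket_xy // -!mul_mpolyC !rmorphN !rmorphD !rmorphN /=.
    by ring.
Qed.

Let br_Om_var (i : 'I_n) v : i != vidx v ->
  br (Om i) 'X_v = wt i v *: (Om i * 'X_v).
Proof.
move=> iv; apply/eqP; rewrite -subr_eq0; apply/eqP.
have termE (l : 'I_n) : l != vidx v ->
    br ((q l - p l) *: (y l * x l)) 'X_v
      - wt i v *: ((q l - p l) *: (y l * x l) * 'X_v)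
    = (wt l v - wt i v) *: ((q l - p l) *: (y l * x l) * 'X_v).
  move=> lv; rewrite brZl br_yx_var // -!mul_mpolyC !rmorphB /=; ring.
rewrite {1}/Om br_suml {1}/Om mulr_suml scaler_sumr -sumrB.
have [lt_iv|lt_vi|/val_inj eq_iv] := ltngtP i (vidx v).
- apply: big1 => l li; have lv := ltn_trans li lt_iv.
  rewrite termE ?neq_ltn ?lv // (_ : wt l v = wt i v) ?subrr ?scale0r //.
  by move: lt_iv lv; rewrite /wt /vidx; case: (split v) => j -> ->.
- rewrite (bigID (fun l : 'I_n => (l < vidx v)%N)) /=.
  rewrite [X in _ + X](bigD1 (vidx v)) /=; last by rewrite lt_vi ltnn.
  rewrite [X in _ + (_ + X)]big1 ?addr0; last first.
    move=> l /andP[/andP[li]]; rewrite -leqNgt => vl lv.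
    rewrite termE // (_ : wt l v = wt i v) ?subrr ?scale0r //.
    move: lt_vi vl; rewrite /wt /vidx; case: (split v) => j ji jl;
      by rewrite ltnNge jl /= ltnNge (ltnW ji).
  have -> : \sum_(l < n | (l < i)%N && (l < vidx v)%N)
        (br ((q l - p l) *: (y l * x l)) 'X_v
          - wt i v *: ((q l - p l) *: (y l * x l) * 'X_v))
      = (match split v with inl j => p j - q j | inr j => q j - p j end)
          *: (Om (vidx v) * 'X_v).
    rewrite /Om mulr_suml scaler_sumr; apply: eq_big => [l|l /andP[li lv]].
      by apply: andb_idl => lv; exact: ltn_trans lv lt_vi.
    rewrite termE ?neq_ltn ?lv //; congr (_ *: _).
    move: lt_vi lv; rewrite /wt /vidx; case: (split v) => j ji ->;
      by rewrite ltnNge (ltnW ji) //= opprK addrC.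
  move: lt_vi; rewrite /wt /vidx; case: (split_ordP v) => j ->;
    rewrite ?split_lshift ?split_rshift -?/(yvar _ _) -?/(xvar _ _) => ji;
    rewrite ltnNge (ltnW ji) /= brZl br_leibniz.
  + rewrite An_bracket_xy_diag -/(Om j) br_alt -!mul_mpolyC !rmorphB /=.
    by ring.
  + rewrite (br_skew (x j) (y j)) An_bracket_xy_diag -/(Om j) br_alt.
    by rewrite -!mul_mpolyC rmorphN !rmorphB /=; ring.
by rewrite eq_iv eqxx in iv.
Qed.

Let jac_rot a b c : jac a b c = jac b c a.
Proof. by rewrite /jac; ring. Qed.

Let jac_swap a b c : jac b a c = - jac a b c.
Proof.
rewrite /jac (br_skew a b) (br_skew c a) (br_skew b c) !brNl; ring.
Qed.

Let jac_aab a b : jac a a b = 0.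
Proof. by rewrite /jac br_alt br0l (br_skew a b) brNl add0r subrr. Qed.

Let jac_yx (i : 'I_n) v : i != vidx v -> jac (x i) (y i) 'X_v = 0.
Proof.
move=> iv; rewrite /jac.
have [a Ea] : exists a, br (x i) 'X_v = a *: (x i * 'X_v).
  by apply: br_var_log; rewrite {1}/vidx split_rshift.
have [b Eb] : exists b, br (y i) 'X_v = b *: (y i * 'X_v).
  by apply: br_var_log; rewrite {1}/vidx split_lshift.
have v0 : 'X_v != 0 :> A.
  by rewrite -msupp_eq0 msuppX.
have wE : wt i v = a + b.
  have := br_yx_var iv; rewrite br_leibniz Ea Eb -!mul_mpolyC => H.
  have : (wt i v - (a + b))%:MP * (y i * x i * 'X_v) == 0.
    by rewrite rmorphB rmorphD /= mulrBl -H; apply/eqP; ring.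
  rewrite !mulf_eq0 -!msupp_eq0 /yvar /xvar !msuppX /= !orbF msupp_eq0.
  by rewrite mpolyC_eq0 subr_eq0 => /eqP.
rewrite An_bracket_xy_diag -/(Om i) brDl brZl br_yx_var // br_Om_var // wE.
rewrite Eb brZl br_leibniz (br_skew (x i) 'X_v) Ea.
rewrite (br_skew (x i) (y i)) An_bracket_xy_diag -/(Om i).
rewrite brNl brZl br_leibniz (br_skew (y i) 'X_v) Eb.
rewrite An_bracket_xy_diag -/(Om i) -!mul_mpolyC rmorphD /=; ring.
Qed.

Let jac_var2 u v w : vidx u = vidx v -> vidx u != vidx w ->
  jac 'X_u 'X_v 'X_w = 0.
Proof.
rewrite {1 2 3}/vidx; case: (split_ordP u) => i ->; case: (split_ordP v) => j ->;
  rewrite ?split_lshift ?split_rshift -?/(yvar _ _) -?/(xvar _ _) => -> jw.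
- exact: jac_aab.
- by rewrite jac_swap jac_yx ?oppr0.
- exact: jac_yx.
- exact: jac_aab.
Qed.

Let jac_var u v w : jac 'X_u 'X_v 'X_w = 0.
Proof.
have [uv|uv] := eqVneq (vidx u) (vidx v).
  have [uw|] := eqVneq (vidx u) (vidx w); last exact: jac_var2.
  have two a b c : [|| a == b, b == c | c == a] -> jac 'X_a 'X_b 'X_c = 0.
    by case/or3P=> /eqP->; [| rewrite jac_rot | rewrite -jac_rot];
       rewrite jac_aab.
  apply: two; move: uv uw; rewrite /vidx.
  case: (split_ordP u) => i1 ->; case: (split_ordP v) => i2 ->;
  case: (split_ordP w) => i3 ->;
    rewrite ?split_lshift ?split_rshift => <- <-; by rewrite eqxx ?orbT.
have [uw|uw] := eqVneq (vidx u) (vidx w).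
  by rewrite -jac_rot jac_var2 // -uw.
have [vw|vw] := eqVneq (vidx v) (vidx w).
  by rewrite jac_rot jac_var2 // eq_sym.
have [a Ea] := br_var_log uv; have [b Eb] := br_var_log vw.
have [c Ec] := br_var_log uw.
rewrite /jac Ea Eb (br_skew 'X_u 'X_w) Ec -scaleNr !brZl !br_leibniz.
rewrite (br_skew 'X_u 'X_v) (br_skew 'X_u 'X_w) (br_skew 'X_v 'X_w) Ea Eb Ec.
rewrite -!mul_mpolyC rmorphN /=; ring.
Qed.

Let jac_eq0 f h e : jac f h e = 0.
Proof.
have jac_der b c : (forall u, jac 'X_u b c = 0) -> forall a, jac a b c = 0.
  move=> j0 a; rewrite (@derivation_mpoly _ (fun a => jac a b c)).
  - by rewrite big1 // => u _; rewrite j0 mul0r.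
  - move=> t a1 a2.
    by rewrite /jac !br_linearr !brDl !brZl -!mul_mpolyC; ring.
  - move=> a1 a2; rewrite /jac !br_leibniz !br_leibnizr !brDl !br_leibniz.
    rewrite (br_skew a1 (br b c)) (br_skew a2 (br b c)).
    rewrite (br_skew c a1) (br_skew c a2) (br_skew b a1) (br_skew b a2).
    by rewrite !brNl; ring.
- apply: (jac_der) => u; rewrite jac_rot; apply: (jac_der) => v; rewrite jac_rot.
  by apply: jac_der => w; rewrite jac_rot; exact: jac_var.
Qed.

Lemma An_bracketP : is_poisson_bracket br.
Proof.
split; [exact: br_linearl | exact: br_linearr | exact: br_alt |
  exact: jac_eq0 | exact: br_leibniz].
Qed.

Lemma An_bracket_uniq (br' : poissonBracket A) :
  (forall u v, br' 'X_u 'X_v = bv u v) -> br' =2 br.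
Proof.
have [Ll Lr _ _ L] := poisson_funP br' => bvE f h.
have Lr' a b c : br' c (a * b) = a * br' c b + b * br' c a.
  rewrite !(poisson_anti (poisson_funP br') c) L; ring.
rewrite (@derivation_mpoly _ (br'^~ h)) //; apply: eq_bigr => u _.
rewrite (@derivation_mpoly _ (br' 'X_u)) // mulr_suml; apply: eq_bigr => v _.
by rewrite bvE; ring.
Qed.

End BracketTheory.

Section AdmissibleSets.
Context (k : fieldType) (n : nat).
Variables (P Q : 'rV[k]_n) (Gamma : 'M[k]_n).
Local Notation A := {mpoly k[n + n]}.
Local Notation y := (@yvar k n).
Local Notation x := (@xvar k n).
Local Notation Omega := (Omega P Q).

Definition An (k_char0 : [pchar k] =i pred0) (Gamma_skew : Gamma^T = - Gamma) :
    poissonBracket A :=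
  PoissonBracket (An_bracketP P Q k_char0 Gamma_skew).

Definition calP : set A :=
  [set f | exists i : 'I_n, [\/ f = Omega i, f = y i | f = x i]].

Definition admissible : set (set A) := [set T : set A |
  [/\ T `<=` calP,
      (forall i j : 'I_n, i = j.+1 :> nat ->
         (T (y i) \/ T (x i)) <-> (T (Omega i) /\ T (Omega j)))
    & (forall i : 'I_n, i = 0%N :> nat ->
         (T (y i) \/ T (x i)) <-> T (Omega i))]].

Definition pspec_at (br : poissonBracket A) (T : set A) : set (set A) :=
  [set I | pspec br I /\ I `&` calP = T].

End AdmissibleSets.

(* Main.v *)
(* Modulo y_i x_i, the bracket {x_i, y_i} is Omega_(i-1), while
   Omega_i - Omega_(i-1) is a nonzero multiple of y_i x_i.  So a Poisson ideal
   containing y_i or x_i contains Omega_(i-1) and Omega_i, and a prime ideal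
   containing both contains y_i x_i, hence y_i or x_i. *)
Require Import Defs.
From mathcomp Require Import all_boot all_order all_algebra.
From mathcomp Require Import mpoly classical_sets.

Set Implicit Arguments.
Unset Strict Implicit.

Import GRing.Theory.
Local Open Scope ring_scope.
Local Open Scope classical_set_scope.

Section PrimePoissonIdeal.
Context (k : fieldType) (A : comAlgType k) (br : poissonBracket A) (I : set A).
Hypothesis Ipspec : pspec br I.

Lemma pspecD a b : I a -> I b -> I (a + b).
Proof.
have [[_ _ Icl] _ _] := Ipspec => Ia Ib; apply/set_mem; rewrite -(mul1r a).
by apply: Icl; exact: mem_set.
Qed.

Lemma pspecMl a b : I b -> I (a * b).
Proof.
have [[I0 _ Icl] _ _] := Ipspec => Ib; apply/set_mem; rewrite -(addr0 (a * b)).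
by apply: Icl => //; exact: mem_set.
Qed.

Lemma pspecZ c a : I a -> I (c *: a).
Proof. by rewrite -mulr_algl; exact: pspecMl. Qed.

Lemma pspecZE c a : c != 0 -> I (c *: a) -> I a.
Proof. by move=> c0 /(pspecZ c^-1); rewrite scalerA mulVf // scale1r. Qed.

Lemma pspecBr a b : I (a + b) -> I a -> I b.
Proof.
move=> Iab /(pspecZ (-1)) INa; have := pspecD Iab INa.
by rewrite scaleN1r addrAC subrr add0r.
Qed.

Lemma pspec_bracketl a b : I a -> I (br a b).
Proof. by have [_ _] := Ipspec; apply. Qed.

(** Stability is only assumed in the first argument of the bracket; antisymmetry transfers it to the
    second. *)
Lemma pspec_bracketr a b : I b -> I (br a b).
Proof.
move=> Ib; rewrite (poisson_anti (poisson_funP br)) -scaleN1r.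
exact/pspecZ/pspec_bracketl.
Qed.

Lemma pspec_prime a b : I (a * b) -> I a \/ I b.
Proof.
have [_ Ipr _] := Ipspec => /mem_set Iab.
by have /orP[/set_mem|/set_mem] := Ipr a b Iab; [left | right].
Qed.

End PrimePoissonIdeal.

Section Spectrum.
Context (k : fieldType) (n : nat) (k_char0 : [pchar k] =i pred0).
Variables (P Q : 'rV[k]_n) (Gamma : 'M[k]_n).
Hypothesis Gamma_skew : Gamma^T = - Gamma.
Hypothesis PQ_neq : forall i : 'I_n, P 0 i <> Q 0 i.
Local Notation y := (@yvar k n).
Local Notation x := (@xvar k n).
Local Notation An := (An P Q k_char0 Gamma_skew).
(** Plays the role of Omega_(i-1), but also makes sense at the first index, where the sum is
    empty. *)
Local Notation Omega_lt i :=
  (\sum_(l < n | (l < i)%N) (Q 0 l - P 0 l) *: (y l * x l)).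

Lemma OmegaE i : Omega P Q i = (Q 0 i - P 0 i) *: (y i * x i) + Omega_lt i.
Proof.
rewrite /Omega (bigD1 i) //=; congr (_ + _); apply: eq_bigl => l.
by rewrite andbC -[l == i]val_eqE ltn_neqAle.
Qed.

Variable I : set {mpoly k[n + n]}.
Hypothesis Ipspec : pspec An I.

(** Covers both admissibility conditions at once, since [Omega_lt i] is the preceding Omega or, at
    the first index, 0. *)
Lemma pspec_yx_iff i : I (y i) \/ I (x i) <-> I (Omega P Q i) /\ I (Omega_lt i).
Proof.
(* The coefficient of [y i * x i] in [Omega P Q i], to be cancelled in the converse. *)
have qp0 : Q 0 i - P 0 i != 0 by rewrite subr_eq0 eq_sym; apply/eqP/PQ_neq.
split=> [Iyx | [IO IOlt]].
  have Iyxi : I (y i * x i).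
    by case: Iyx => ?; first rewrite mulrC; exact: (pspecMl Ipspec).
  have Ibr : I (An (x i) (y i)).
    by case: Iyx => ?;
      [exact: (pspec_bracketr Ipspec) | exact: (pspec_bracketl Ipspec)].
  have IOlt : I (Omega_lt i).
    (* The bracket is a multiple of [y i * x i], already in [I], plus [Omega_lt i]. *)
    move: Ibr; rewrite /= An_bracket_xy_diag // => Ibr.
    exact: (pspecBr Ipspec Ibr) (pspecZ Ipspec _ Iyxi).
  split=> //; rewrite OmegaE; apply: (pspecD Ipspec) => //.
  exact: (pspecZ Ipspec).
apply: (pspec_prime Ipspec); apply: (pspecZE Ipspec qp0).
by apply: (pspecBr Ipspec) IOlt; rewrite addrC -OmegaE.
Qed.

Lemma pspec_admissible : admissible P Q (I `&` calP P Q).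
Proof.
(* Variables and Omegas all lie in [calP], so intersecting with it does not affect their
   membership. *)
have cap i : [/\ (I `&` calP P Q) (y i) <-> I (y i),
    (I `&` calP P Q) (x i) <-> I (x i)
  & (I `&` calP P Q) (Omega P Q i) <-> I (Omega P Q i)].
  by split; (split=> [[]//|If]; split=> //; exists i);
    [apply: Or32 | apply: Or33 | apply: Or31].
split=> [|i j ij|i i0]; first by move=> f [].
- have [-> -> ->] := cap i; have [_ _ ->] := cap j.
  (* With [i = j.+1], the strict bound [l < i] is [l <= j]. *)
  rewrite pspec_yx_iff; suff -> : Omega_lt i = Omega P Q j by [].
  by apply: eq_bigl => l; rewrite ij ltnS.
- have [-> -> ->] := cap i; rewrite pspec_yx_iff.
  (* At the first index the second condition becomes [I 0], obtained as a zero multiple of an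
     element of [I]. *)
  rewrite [Omega_lt i]big_pred0 => [|l]; last by rewrite i0.
  split=> [[]//|IO]; split=> //.
  by rewrite -(scale0r (Omega P Q i)); exact: (pspecZ Ipspec).
Qed.

End Spectrum.

Theorem proposition2p8 (k : closedFieldType) (k_char0 : [pchar k] =i pred0)
    (n : nat) (P Q : 'rV[k]_n) (Gamma : 'M[k]_n)
    (Gamma_skew : Gamma^T = - Gamma)
    (PQ_neq : forall i : 'I_n, P 0 i <> Q 0 i) :
  (forall I : set {mpoly k[n + n]},
      pspec (An P Q k_char0 Gamma_skew) I -> admissible P Q (I `&` calP P Q))
  /\ (pspec (An P Q k_char0 Gamma_skew)
        = \bigcup_(T in admissible P Q)
             pspec_at P Q (An P Q k_char0 Gamma_skew) T
      /\ trivIset (admissible P Q) (pspec_at P Q (An P Q k_char0 Gamma_skew))).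
Proof.
have adm I : pspec (An P Q k_char0 Gamma_skew) I ->
    admissible P Q (I `&` calP P Q) by exact: pspec_admissible.
(* Disjointness: an ideal common to two strata determines both labels as its intersection with
   [calP]. *)
split=> //; split; last by move=> T1 T2 _ _ [I [[_ <-] [_ <-]]].
apply/seteqP; split=> [I Ip|I [T _ []//]].
by exists (I `&` calP P Q); [exact: adm | split].
Qed.
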